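(* Let $G$ be an $(r,s)$-directed hypergraph and let $p,q\ge1$ be real numbers with $r/p+s/q>1$. If $G$ is hyperbolic $\alpha$-subnormal, then $$\lambda_{p,q}(G)\le\frac{1}{r^{r/p}s^{s/q}\alpha}.$$
   Context: Let $r,s$ be positive integers. An $(r,s)$-directed hypergraph $G$ consists of a finite vertex set $V(G)$ and a finite set $E(G)$ of arcs. Each arc $e$ is an ordered pair $(T(e),H(e))$ of disjoint subsets of $V(G)$ (tail and head) with $|T(e)|=r$ and $|H(e)|=s$. Write $T(G)=\bigcup_eT(e)$ and $H(G)=\bigcup_eH(e)$. For real vectors $\mathbf{x}=(x_u)_{u\in T(G)}$ and $\mathbf{y}=(y_v)_{v\in H(G)}$, indexed independently, set $P_G(\mathbf x,\mathbf y)=\sum_{e\in E(G)}\prod_{u\in T(e)}x_u\prod_{v\in H(e)}y_v$. For real $p,q\ge1$ let $\lambda_{p,q}(G)=\max\{P_G(\mathbf x,\mathbf y):\|\mathbf x\|_p=\|\mathbf y\|_q=1\}$. A weighted incidence matrix of $G$ is a matrix $B=(B(v,e))_{v\in V(G),e\in E(G)}$ with $B(v,e)>0$ if $v\in T(e)\cup H(e)$ and $B(v,e)=0$ otherwise. For $r/p+s/q>1$, $G$ is hyperbolic $\alpha$-subnormal if there is a weighted incidence matrix $B$ with: (1) $\sum_{e:\,u\in T(e)}B(u,e)\le1$ for all $u\in T(G)$, and $\sum_{e:\,v\in H(e)}B(v,e)\le1$ for all $v\in H(G)$; (2) $\prod_{u\in T(e)}B(u,e)^{1/p}\prod_{v\in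 H(e)}B(v,e)^{1/q}\ge\alpha$ for every $e\in E(G)$. *)

(* Defs.v *)
From HB Require Import structures.
From mathcomp Require Import all_boot all_order all_algebra.
From mathcomp Require Import all_classical all_reals all_analysis.

Set Implicit Arguments.
Unset Strict Implicit.
Unset Printing Implicit Defensive.

Import Order.TTheory GRing.Theory Num.Theory.
Import numFieldNormedType.Exports.

Local Open Scope ring_scope.

(* The pair e encodes the arc with tail e.1 and head e.2. *)
Definition is_arc (r s : nat) (V : finType) (e : {set V} * {set V}) : bool :=
  [&& [disjoint e.1 & e.2], #|e.1| == r & #|e.2| == s].

Record dihypergraph (r s : nat) (V : finType) := DiHypergraph {
  arcs : {set {set V} * {set V}};
  arcsP : forall e, e \in arcs -> is_arc r s e
}.

Section Dihypergraph.
Variables (R : realType) (r s : nat) (V : finType).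
Implicit Type G : dihypergraph r s V.

Definition tails G : {set V} := \bigcup_(e in arcs G) e.1.
Definition heads G : {set V} := \bigcup_(e in arcs G) e.2.

(* The l^p norm of the family (x_u) indexed by u \in A.  A vector indexed by
   A is represented by a function on V whose values outside A are never used. *)
Definition lpnorm (A : {set V}) (p : R) (x : V -> R) : R :=
  (\sum_(u in A) `|x u| `^ p) `^ p^-1.

Definition polyform G (x y : V -> R) : R :=
  \sum_(e in arcs G) (\prod_(u in e.1) x u) * (\prod_(v in e.2) y v).

Definition feasible (p q : R) G (x y : V -> R) : Prop :=
  lpnorm (tails G) p x = 1 /\ lpnorm (heads G) q y = 1.

Definition form_values (p q : R) G : set R :=
  [set m | exists x y, feasible p q G x y /\ m = polyform G x y]%classic.

(* This supremum is a maximum as soon as G has an arc: see lambda_max.  When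
   G has no arc, form_values is empty and its sup is 0 by convention. *)
Definition lambda (p q : R) G : R := sup (form_values p q G).

Definition weighted_incidence G (B : V -> {set V} * {set V} -> R) : Prop :=
  forall v e, e \in arcs G ->
    (v \in e.1 :|: e.2 -> 0 < B v e) /\ (v \notin e.1 :|: e.2 -> B v e = 0).

Definition hyperbolic_subnormal (p q alpha : R) G : Prop :=
  exists B : V -> {set V} * {set V} -> R,
    [/\ weighted_incidence G B,
        forall u, u \in tails G -> \sum_(e in arcs G | u \in e.1) B u e <= 1,
        forall v, v \in heads G -> \sum_(e in arcs G | v \in e.2) B v e <= 1
      & forall e, e \in arcs G ->
          alpha <= (\prod_(u in e.1) B u e `^ p^-1) *
                   (\prod_(v in e.2) B v e `^ q^-1)].

End Dihypergraph.

Section LambdaMax.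
Local Open Scope classical_set_scope.
Variables (R : realType) (r s : nat) (V : finType).
Implicit Type G : dihypergraph r s V.

Lemma continuous_normpowR (p : R) : 0 < p ->
  continuous (fun a : R => `|a| `^ p).
Proof.
move=> p0 a; have [->|a0] := eqVneq a 0.
  rewrite /continuous_at normr0 powR0 ?gt_eqF//.
  apply/cvgr0Pnorm_lt => e e0; have d0 : 0 < e `^ p^-1 by rewrite powR_gt0.
  near=> b.
  have bd : `|b| < e `^ p^-1.
    by near: b; apply: (@cvgr0_norm_lt R R R (nbhs 0) _ id).
  rewrite ger0_norm ?powR_ge0//.
  have -> : e = (e `^ p^-1) `^ p by rewrite -powRrM mulVf ?gt_eqF// powRr1// ltW.
  by rewrite gt0_ltr_powR// ?nnegrE ?normr_ge0 ?powR_ge0.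
have na0 : 0 < `|a| by rewrite normr_gt0.
apply: (@continuous_comp _ _ _ (fun b : R => `|b|) (fun b => b `^ p)).
  exact: norm_continuous.
apply: differentiable_continuous; apply/derivable1_diffP.
by apply: derivable_powR; rewrite in_itv /= na0.
Unshelve. all: by end_near. Qed.

Lemma lpnorm1P (A : {set V}) (p : R) (x : V -> R) : 0 < p ->
  lpnorm A p x = 1 <-> \sum_(u in A) `|x u| `^ p = 1.
Proof.
move=> p0; rewrite /lpnorm; split=> [|->]; last by rewrite powR1.
set S := \sum_(_ in _) _ => SE.
have S0 : 0 <= S by apply: sumr_ge0 => u _; exact: powR_ge0.
have : (S `^ p^-1) `^ p = 1 by rewrite SE powR1.
by rewrite -powRrM mulVf ?gt_eqF// powRr1.
Qed.

Lemma continuous_bigsum (T : topologicalType) (I : finType) (P : pred I)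
    (F : I -> T -> R) : (forall i, P i -> continuous (F i)) ->
  continuous (fun z => \sum_(i | P i) F i z).
Proof. by move=> cF; apply: continuous_big => //; exact: add_continuous. Qed.

Lemma continuous_bigprod (T : topologicalType) (I : finType) (P : pred I)
    (F : I -> T -> R) : (forall i, P i -> continuous (F i)) ->
  continuous (fun z => \prod_(i | P i) F i z).
Proof. by move=> cF; apply: continuous_big => //; exact: mul_continuous. Qed.

Lemma le1_lpsum (A : {set V}) (p : R) (x : V -> R) u : 0 < p ->
  \sum_(u in A) `|x u| `^ p = 1 -> u \in A -> -1 <= x u <= 1.
Proof.
move=> p0 Sx uA; rewrite -ler_norml.
have : `|x u| `^ p <= 1 `^ p.
  rewrite powR1 -Sx (bigD1 u)//= lerDl.
  by apply: sumr_ge0 => v _; exact: powR_ge0.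
apply: contraTT; rewrite -!ltNge => x1.
by rewrite gt0_ltr_powR// nnegrE ?ler01 ?normr_ge0.
Qed.

Lemma lambda_max (p q : R) G : (0 < r)%N -> (0 < s)%N -> 1 <= p -> 1 <= q ->
  arcs G != finset.set0 ->
  form_values p q G (lambda p q G) /\
  (forall m, form_values p q G m -> m <= lambda p q G).
Proof.
move=> r0 s0 p1 q1 /set0Pn[e0 e0G].
have p0 : 0 < p by exact: lt_le_trans p1.
have q0 : 0 < q by exact: lt_le_trans q1.
suff [m [mG mmax]] : exists m, form_values p q G m /\ ubound (form_values p q G) m.
  have sG : has_sup (form_values p q G) by split; exists m.
  have -> : lambda p q G = m.
    apply/le_anti/andP; split; first by apply: ge_sup => //; exists m.
    by apply: ub_le_sup => //; exists m.
  by split=> // m' /mmax.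
pose T := prod_topology (fun _ : (V + V)%type => R).
pose lft (z : T) : V -> R := fun u => z (inl u).
pose rgt (z : T) : V -> R := fun u => z (inr u).
pose nt (z : T) : R := \sum_(u in tails G) `|lft z u| `^ p.
pose nh (z : T) : R := \sum_(u in heads G) `|rgt z u| `^ q.
pose K : set T := [set z : T | forall i, [set` `[-1, 1]%R] (z i)].
pose C : set T := K `&` (nt @^-1` [set 1] `&` nh @^-1` [set 1]).
have projc i : continuous (fun z : T => z i : R).
  exact: (@proj_continuous _ (fun _ : (V + V)%type => R) i).
have ntc : continuous nt.
  apply: continuous_bigsum => u _ z.
  apply: (@continuous_comp _ _ _ (fun z : T => z (inl u) : R) (fun b : R => `|b| `^ p)).
    exact: projc.
  exact: continuous_normpowR.
have nhc : continuous nh.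
  apply: continuous_bigsum => u _ z.
  apply: (@continuous_comp _ _ _ (fun z : T => z (inr u) : R) (fun b : R => `|b| `^ q)).
    exact: projc.
  exact: continuous_normpowR.
have cK : compact K.
  apply: (@tychonoff _ (fun _ : (V + V)%type => R) (fun _ => [set` `[-1, 1]%R])).
  by move=> _; exact: segment_compact.
have cC : compact C.
  apply: compact_closedI => //.
  apply: closedI.
    by apply: preimage_closed => //; exact: closed_eq.
  by apply: preimage_closed => //; exact: closed_eq.
have cf : continuous (fun z : T => polyform G (lft z) (rgt z)).
  apply: continuous_bigsum => e _ z.
  apply: (@continuousM _ T (fun z : T => \prod_(u in e.1) lft z u)
                           (fun z : T => \prod_(v in e.2) rgt z v)).
    by apply: continuous_bigprod => u _; exact: projc.
  by apply: continuous_bigprod => u _; exact: projc.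
have /and3P[_ /eqP ce1 /eqP ce2] := arcsP e0G.
have [u0 u0e] : exists u, u \in e0.1.
  by apply/set0Pn; rewrite -card_gt0 ce1.
have [v0 v0e] : exists v, v \in e0.2.
  by apply/set0Pn; rewrite -card_gt0 ce2.
have u0T : u0 \in tails G by apply/bigcupP; exists e0.
have v0H : v0 \in heads G by apply/bigcupP; exists e0.
have delta1 (A : {set V}) (t : R) w : 0 < t -> w \in A ->
    \sum_(u in A) `|(u == w)%:R : R| `^ t = 1.
  move=> t0 wA; rewrite (bigD1 w)//= eqxx normr1 powR1 big1 ?addr0// => u.
  by case/andP=> _ /negPf ->; rewrite normr0 powR0// gt_eqF.
have C0 : C !=set0.
  exists (fun i => match i with inl u => (u == u0)%:R | inr v => (v == v0)%:R end).
  split; last by split; rewrite /= /nt /nh /lft /rgt delta1.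
  by case=> u /=; rewrite in_itv/=; case: (_ == _); rewrite ?lexx ?ler01 ?lerN10 ?gerN10 ?andbT //= ?(le_trans (lerN10 _))// ?ler01.
have [z zC zmax] := compact_EVT_max C0 cC (continuous_subspaceT cf).
exists (polyform G (lft z) (rgt z)); split.
  have [_ [z1 z2]] := set_mem zC.
  by exists (lft z), (rgt z); split=> //; split; apply/lpnorm1P.
move=> _ [x [y [[/lpnorm1P-/(_ p0) nx /lpnorm1P-/(_ q0) ny] ->]]].
pose w : T := fun i => match i with
  | inl u => if u \in tails G then x u else 0
  | inr v => if v \in heads G then y v else 0 end.
have -> : polyform G x y = polyform G (lft w) (rgt w).
  apply: eq_bigr => e eG; congr (_ * _); apply: eq_bigr => u ue.
    by rewrite /lft /w ifT//; apply/bigcupP; exists e.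
  by rewrite /rgt /w ifT//; apply/bigcupP; exists e.
apply: zmax; apply: mem_set; split.
  have zero_in : -1 <= (0 : R) <= 1 by rewrite lerN10 ler01.
  case=> u /=; rewrite in_itv /=; case: ifPn => // uA.
    exact: le1_lpsum nx uA.
  exact: le1_lpsum ny uA.
split; rewrite /= /nt /nh /lft /rgt /w.
  by rewrite -[RHS]nx; apply: eq_bigr => u ->.
by rewrite -[RHS]ny; apply: eq_bigr => u ->.
Qed.
End LambdaMax.

(* Main.v *)
(** With weights [B u e * |x u|^p] on the tail of an arc [e] and
    [B v e * |y v|^q] on its head, condition (2) bounds [alpha] times the term
    of [e] by the product of the [1/p]-th and [1/q]-th powers of these weights.
    AM-GM replaces that product by [(S e / r)^(r/p) * (T e / s)^(s/q)], where
    [S e] and [T e] are the sums of the weights.  By condition (1) both [S] and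
    [T] have total mass at most 1 over all arcs, and as [r/p + s/q >= 1] a
    weighted AM-GM (Hoelder) gives [\sum_e (S e)^(r/p) * (T e)^(s/q) <= 1]. *)
Require Import Defs.
From mathcomp Require Import all_boot all_order all_algebra.
From mathcomp Require Import all_classical all_reals all_analysis.

Import Order.TTheory GRing.Theory Num.Theory.

Local Open Scope ring_scope.

Lemma powR_prod (R : realType) (I : finType) (P : pred I) (a : I -> R) (c : R) :
  (forall i, P i -> 0 <= a i) ->
  \prod_(i | P i) a i `^ c = (\prod_(i | P i) a i) `^ c.
Proof.
move=> a0; suff [] : \prod_(i | P i) a i `^ c = (\prod_(i | P i) a i) `^ c /\
    0 <= \prod_(i | P i) a i by [].
apply: (big_ind2 (fun x y => x = y `^ c /\ 0 <= y)).
- by rewrite powR1.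
- by move=> x y x' y' [-> y0] [-> y'0]; rewrite powRM ?mulr_ge0.
- by move=> i /a0.
Qed.

(** With [n = #|A|], both sides are [p^-1]-th powers, which reduces the claim to
    [n ^ n * \prod a i <= (\sum a i) ^ n], that is AM-GM with denominators cleared. *)
Lemma AGM_powR (R : realType) (I : finType) (A : {set I}) (a : I -> R) (p : R) :
  0 <= p -> (forall i, i \in A -> 0 <= a i) ->
  #|A|%:R `^ (#|A|%:R / p) * \prod_(i in A) a i `^ p^-1 <=
  (\sum_(i in A) a i) `^ (#|A|%:R / p).
Proof.
move=> p0 a0; have S0 : 0 <= \sum_(i in A) a i by exact: sumr_ge0.
have P0 : 0 <= \prod_(i in A) a i by exact: prodr_ge0.
rewrite powR_prod// !powRrM !powR_mulrn// -powRM ?exprn_ge0//.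
rewrite ge0_ler_powR ?invr_ge0 ?nnegrE ?mulr_ge0 ?exprn_ge0//.
(* An empty [A] is treated apart, because the mean divides by [#|A|]. *)
have [cA|cA] := posnP #|A|.
  by rewrite cA !expr0 mul1r (cards0_eq cA) big_set0.
rewrite mulrC -ler_pdivlMr ?exprn_gt0 ?ltr0n// -expr_div_n.
exact: (leif_AGM a0).
Qed.

(** Normalise the exponents to [c + d = 1]. As [x] and [y] are at most 1, so is [x^c * y^d], and
    raising it to the power [a + b >= 1] can only decrease it. Young's inequality with conjugate
    exponents [1/c] and [1/d] bounds what remains. *)
Lemma weighted_AGM_le1 (R : realType) (a b x y : R) :
  0 < a -> 0 < b -> 1 <= a + b -> 0 <= x <= 1 -> 0 <= y <= 1 ->
  x `^ a * y `^ b <= (a * x + b * y) / (a + b).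
Proof.
move=> a0 b0 ab1 /andP[x0 x1] /andP[y0 y1].
have ab0 : 0 < a + b by rewrite addr_gt0.
pose c := a / (a + b); pose d := b / (a + b).
have c0 : 0 < c by rewrite divr_gt0.
have d0 : 0 < d by rewrite divr_gt0.
have cd1 : c^-1^-1 + d^-1^-1 = 1.
  by rewrite !invrK -mulrDl divff// gt_eqF.
have powle1 (z t : R) : 0 <= z -> z <= 1 -> 0 <= t -> z `^ t <= 1.
  move=> z0 z1 t0; have <- : 1 `^ t = 1 by rewrite powR1.
  by rewrite ge0_ler_powR ?nnegrE.
have le_unscaled : x `^ a * y `^ b <= x `^ c * y `^ d.
  have ca : a = c * (a + b) by rewrite divfK// gt_eqF.
  have db : b = d * (a + b) by rewrite divfK// gt_eqF.
  rewrite [in x `^ a]ca [in y `^ b]db !(powRrM _ _ (a + b)) -powRM ?powR_ge0//.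
  have : 0 <= x `^ c * y `^ d by rewrite mulr_ge0 ?powR_ge0.
  (* Comparing powers of a number in []0, 1]] needs a positive base, so the value 0 is split off. *)
  rewrite le_eqVlt => /predU1P[<-|z0]; first by rewrite powR0// gt_eqF.
  by rewrite ge1r_powR// z0 mulr_ile1 ?powR_ge0 ?powle1// ltW.
apply: (le_trans le_unscaled).
have := conjugate_powR (powR_ge0 x c) (powR_ge0 y d) _ _ cd1.
rewrite !invr_gt0 => /(_ c0 d0).
rewrite -!powRrM !mulfV ?gt_eqF// !powRr1// !invrK.
by rewrite /c /d !mulrA -mulrDl [x * a]mulrC [y * b]mulrC.
Qed.

(** Double counting: after exchanging the sums, each [w u] carries the row sum of [B] at [u], which
    is at most 1. The map [t] stands for tails or heads. *)
Lemma incidence_mass_le (R : realType) (V E : finType) (S : {set E})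
    (t : E -> {set V}) (B : V -> E -> R) (w : V -> R) :
  (forall u, 0 <= w u) ->
  (forall u, u \in \bigcup_(e in S) t e ->
    \sum_(e in S | u \in t e) B u e <= 1) ->
  \sum_(e in S) \sum_(u in t e) B u e * w u <=
  \sum_(u in \bigcup_(e in S) t e) w u.
Proof.
move=> w0 B1.
rewrite (exchange_big_dep (fun u => u \in \bigcup_(e in S) t e))/=; last first.
  by move=> e u eS ue; apply/bigcupP; exists e.
by apply: ler_sum => u uS; rewrite -mulr_suml ler_piMl// B1.
Qed.

(** Separates one side of an arc into its factor in condition (2) and the modulus of its
    monomial. *)
Lemma incidence_term_powR (R : realType) (V : finType) (A : {set V})
    (b x : V -> R) (p : R) : 0 < p -> (forall u, u \in A -> 0 <= b u) ->
  \prod_(u in A) (b u * `|x u| `^ p) `^ p^-1 =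
  (\prod_(u in A) b u `^ p^-1) * `|\prod_(u in A) x u|.
Proof.
move=> p0 b0; rewrite normr_prod -big_split/=; apply: eq_bigr => u uA.
by rewrite powRM ?b0 ?powR_ge0// -powRrM mulfV ?gt_eqF// powRr1.
Qed.

Theorem theorem4p24 (R : realType) (r s : nat) (hr : (0 < r)%N) (hs : (0 < s)%N)
    (V : finType) (G : dihypergraph r s V) (p q alpha : R)
    (hp : 1 <= p) (hq : 1 <= q) (hpq : 1 < r%:R / p + s%:R / q)
    (halpha : 0 < alpha) (hG : hyperbolic_subnormal p q alpha G) :
  lambda p q G <= 1 / (r%:R `^ (r%:R / p) * s%:R `^ (s%:R / q) * alpha).
Proof.
have p0 : 0 < p by exact: lt_le_trans hp.
have q0 : 0 < q by exact: lt_le_trans hq.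
have r0 : (0 : R) < r%:R by rewrite ltr0n.
have s0 : (0 : R) < s%:R by rewrite ltr0n.
have [B [BG Btail Bhead Balpha]] := hG.
set c := r%:R `^ (r%:R / p); set d := s%:R `^ (s%:R / q).
have c0 : 0 < c by exact: powR_gt0.
have d0 : 0 < d by exact: powR_gt0.
(* Without feasible vectors the supremum is 0 by convention, and the bound is nonnegative. *)
rewrite /lambda; have [->|ne] := eqVneq (form_values p q G) set0%classic.
  by rewrite sup0 divr_ge0 ?mulr_ge0 ?ltW.
apply: ge_sup; first exact/set0P.
move=> _ [x [y [[/(lpnorm1P _ _ p0) nx /(lpnorm1P _ _ q0) ny] ->]]].
pose wt e u := B u e * `|x u| `^ p; pose wh e v := B v e * `|y v| `^ q.
pose S (e : {set V} * {set V}) := \sum_(u in e.1) wt e u.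
pose T (e : {set V} * {set V}) := \sum_(v in e.2) wh e v.
have BT e u : e \in arcs G -> u \in e.1 -> 0 <= B u e.
  by move=> eG ue; apply/ltW/(BG u e eG).1; rewrite inE ue.
have BH e v : e \in arcs G -> v \in e.2 -> 0 <= B v e.
  by move=> eG ve; apply/ltW/(BG v e eG).1; rewrite inE ve orbT.
have wt0 e u : e \in arcs G -> u \in e.1 -> 0 <= wt e u.
  by move=> eG ue; rewrite mulr_ge0 ?powR_ge0 ?BT.
have wh0 e v : e \in arcs G -> v \in e.2 -> 0 <= wh e v.
  by move=> eG ve; rewrite mulr_ge0 ?powR_ge0 ?BH.
have S0 e : e \in arcs G -> 0 <= S e by move=> eG; apply: sumr_ge0 => u /(wt0 _ _ eG).
have T0 e : e \in arcs G -> 0 <= T e by move=> eG; apply: sumr_ge0 => u /(wh0 _ _ eG).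
have sumS : \sum_(e in arcs G) S e <= 1.
  by rewrite -nx; apply: incidence_mass_le => // u; exact: powR_ge0.
have sumT : \sum_(e in arcs G) T e <= 1.
  by rewrite -ny; apply: incidence_mass_le => // u; exact: powR_ge0.
(* Nonnegative terms of total at most 1 are each at most 1, as [weighted_AGM_le1] requires of [S e]
   and [T e]. *)
have le1 F : (forall e, e \in arcs G -> 0 <= F e) -> \sum_(e in arcs G) F e <= 1 ->
    forall e, e \in arcs G -> F e <= (1 : R).
  move=> F0 F1 e eG; apply: le_trans F1; rewrite (bigD1 e)//= lerDl.
  by apply: sumr_ge0 => f /andP[/F0].
rewrite ler_pdivlMr ?mulr_gt0// mulr_suml.
set a := r%:R / p in hpq *; set b := s%:R / q in hpq *.
have a0 : 0 < a by rewrite divr_gt0.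
have b0 : 0 < b by rewrite divr_gt0.
apply: (@le_trans _ _ (\sum_(e in arcs G) (a * S e + b * T e) / (a + b))).
  apply: ler_sum => e eG.
  apply: le_trans (weighted_AGM_le1 _ _ _ _ _ a0 b0 (ltW hpq) _ _); last 2 first.
  - by rewrite S0// (le1 _ S0 sumS).
  - by rewrite T0// (le1 _ T0 sumT).
  have /and3P[_ /eqP er /eqP es] := arcsP eG.
  have agmS := AGM_powR _ _ _ _ _ (ltW p0) (wt0 e ^~ eG).
  have agmT := AGM_powR _ _ _ _ _ (ltW q0) (wh0 e ^~ eG).
  rewrite er in agmS; rewrite es in agmT.
  apply: le_trans (ler_pM _ _ agmS agmT); last 2 first.
  - by rewrite mulr_ge0 ?powR_ge0//; apply: prodr_ge0 => u _; exact: powR_ge0.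
  - by rewrite mulr_ge0 ?powR_ge0//; apply: prodr_ge0 => u _; exact: powR_ge0.
  rewrite !incidence_term_powR//; [|by move=> v /(BH _ _ eG)|by move=> u /(BT _ _ eG)].
  set X := \prod_(u in e.1) x u; set Y := \prod_(v in e.2) y v.
  (* The vectors may have negative entries, whereas the weights only see absolute values. *)
  have XY : X * Y <= `|X| * `|Y| by rewrite -normrM ler_norm.
  have := ler_pM (ltW halpha) _ (Balpha e eG) (lexx (`|X| * `|Y|)).
  rewrite mulr_ge0// => /(_ isT) le2.
  rewrite mulrC -[leLHS]mulrA [leRHS]mulrACA -/c -/d ler_pM2l ?mulr_gt0//.
  rewrite [leRHS]mulrACA; apply: le_trans le2.
  by rewrite ler_pM2l.
(* What is left is a weighted mean of the total masses of [S] and [T], both at most 1. *)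
rewrite -mulr_suml big_split/= -!mulr_sumr ler_pdivrMr ?addr_gt0// mul1r.
by rewrite lerD// ler_piMr// ltW.
Qed.
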